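(* Let $\lambda\in X_*$ and let $\epsilon^\lambda=s_{i_1}\cdots s_{i_k}\tau$ be a reduced expression, with $i_\nu\in\{0,\dots,r\}$, $\tau\in\Omega$ and $k=\ell(\epsilon^\lambda)$. Let $\varepsilon_1,\dots,\varepsilon_k\in\{\pm1\}$ be the signs attached to the word $s_{i_1}\cdots s_{i_k}$ by the standard orientation. Then in $\mathcal H$ $$\Theta_\lambda=\tilde T_{i_1}^{\varepsilon_1}\cdots\tilde T_{i_k}^{\varepsilon_k}\tilde T_\tau .$$
   Context: Let $(X^*,X_*,R,R^\vee,\Delta)$ be a reduced and irreducible based root datum, $\Delta$ the set of simple roots, $r=\#\Delta$, $W$ the finite Weyl group, generated by the simple reflections $s_1,\dots,s_r$, and $\widetilde W=X_*\rtimes W$ the extended affine Weyl group, acting on $X_{*,\mathbb R}=X_*\otimes\mathbb R$; $\epsilon^\lambda\in\widetilde W$ denotes the translation by $\lambda\in X_*$. Let $\alpha_0$ be the highest root, $s_0=\epsilon^{\alpha_0^\vee}s_{\alpha_0}$, $S_a=\{s_0,\dots,s_r\}$, and $W_a\subseteq\widetilde W$ the affine Weyl group generated by $S_a$. The affine root hyperplanes are $H_{\alpha,n}=\{x\in X_{*,\mathbb R}:\langle\alpha,x\rangle=n\}$ for $\alpha\in R$, $n\in\mathbb Z$. Alcoves are the connected components of the complement of their union; the base alcove $\mathbf a$ is the alcove in the dominant Weyl chamber whose closure contains the origin. The wall of type $i$ of $\mathbf a$ is the hyperplane fixed by $s_i$, and the wall of type $i$ of $x\mathbf a$ ($x\in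 W_a$) is its image under $x$. Length function on $\widetilde W$: $\ell(w\epsilon^\lambda)=\sum_{\alpha>0,\,w(\alpha)<0}|\langle\alpha,\lambda\rangle+1|+\sum_{\alpha>0,\,w(\alpha)>0}|\langle\alpha,\lambda\rangle|$ for $w\in W$, $\lambda\in X_*$; it extends the Coxeter length on $W_a$. $\Omega\subseteq\widetilde W$ is the subgroup of elements of length $0$. Fix a commutative ring $k_0$, an invertible $v\in k_0$, put $q=v^2$, $q^{1/2}=v$. The braid group of $\widetilde W$ has generators $T_w$ ($w\in\widetilde W$) and relations $T_wT_{w'}=T_{ww'}$ whenever $\ell(ww')=\ell(w)+\ell(w')$. The affine Hecke algebra $\mathcal H$ is the quotient of the group algebra over $k_0$ of this braid group by the two-sided ideal generated by $(T_s+1)(T_s-q)$, $s\in S_a$. Put $\tilde T_w=q^{-\ell(w)/2}T_w$ and $\tilde T_i=\tilde T_{s_i}$. For $\lambda\in X_*$ define $\Theta_\lambda=\tilde T_{\epsilon^{\lambda_1}}\tilde T_{\epsilon^{\lambda_2}}^{-1}\in\mathcal H$, where $\lambda=\lambda_1-\lambda_2$ with $\lambda_1,\lambda_2\in X_*$ dominant (this is independent of the choice of $\lambda_1,\lambda_2$). Signs (standard orientation): for each positive root $\alpha$ and $j\in\mathbb Z$ the positive side of $H_{\alpha,j}$ is $\{x:\langle\alpha,x\rangle>j\}$ and the negative side is $\{x:\langle\alpha,x\rangle<j\}$. For a word $s_{i_1}\cdots s_{i_k}$ and $\nu=1,\dots,k$ put $x_\nu=s_{i_1}\cdots s_{i_{\nu-1}}$;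 then $\varepsilon_\nu=+1$ if $x_\nu\mathbf a$ is on the negative side of its wall of type $i_\nu$, and $\varepsilon_\nu=-1$ if it is on the positive side. *)

(* Defs.v *)
From HB Require Import structures.
From mathcomp Require Import all_boot all_order all_algebra.
From mathcomp Require Import finmap.
From mathcomp Require Import boolp classical_sets functions reals topology normedtype.

Set Implicit Arguments.
Unset Strict Implicit.
Unset Printing Implicit Defensive.

Import Order.TTheory GRing.Theory Num.Theory.
Import numFieldNormedType.Exports.

Local Open Scope quotient_scope.
Local Open Scope classical_set_scope.
Local Open Scope ring_scope.

Section PresentedGroup.
Variables (X : choiceType) (rels : seq (X * bool) -> seq (X * bool) -> Prop).

(* [(x, true)] is the letter x, [(x, false)] is its formal inverse;
   [rels u v] is the relation u = v. *)
Inductive pres_cong : seq (X * bool) -> seq (X * bool) -> Prop :=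
| pres_rel u v : rels u v -> pres_cong u v
| pres_cancel x b : pres_cong [:: (x, b); (x, ~~ b)] [::]
| pres_refl u : pres_cong u u
| pres_sym u v : pres_cong u v -> pres_cong v u
| pres_trans u v w : pres_cong u v -> pres_cong v w -> pres_cong u w
| pres_cat u u' v v' :
    pres_cong u u' -> pres_cong v v' -> pres_cong (u ++ v) (u' ++ v').

Definition pres_rel_bool (u v : seq (X * bool)) : bool := `[< pres_cong u v >].

Lemma pres_rel_bool_equiv : equiv_class_of pres_rel_bool.
Proof.
split=> [u|u v|v u w].
- exact/asboolP/pres_refl.
- by apply/asboolP/asboolP => /pres_sym.
- move=> /asboolP uv /asboolP vw; apply/asboolP; exact: pres_trans uv vw.
Qed.

Canonical pres_equiv := EquivRelPack pres_rel_bool_equiv.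
Canonical pres_encModRel := defaultEncModRel pres_rel_bool.

Definition presented_group : Type := {eq_quot pres_rel_bool}.

HB.instance Definition _ := Choice.copy presented_group {eq_quot pres_rel_bool}.

Definition pres_class (u : seq (X * bool)) : presented_group :=
  \pi_{eq_quot pres_rel_bool} u.
Definition pres_repr (g : presented_group) : seq (X * bool) :=
  repr (g : {eq_quot pres_rel_bool}).

Lemma pres_classP u v : pres_class u = pres_class v <-> pres_cong u v.
Proof.
split.
  by move=> /eqquotP /asboolP.
by move=> uv; apply/eqquotP/asboolP.
Qed.

Lemma pres_class_repr g : pres_class (pres_repr g) = g.
Proof. exact: reprK. Qed.

Definition pres_mul (g h : presented_group) := pres_class (pres_repr g ++ pres_repr h).
Definition pres_one : presented_group := pres_class [::].
Definition word_inv (u : seq (X * bool)) := rev [seq (l.1, ~~ l.2) | l <- u].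
Definition pres_inv (g : presented_group) := pres_class (word_inv (pres_repr g)).

Lemma pres_mulE u v : pres_mul (pres_class u) (pres_class v) = pres_class (u ++ v).
Proof. by apply/pres_classP/pres_cat; apply/pres_classP/pres_class_repr. Qed.

Lemma word_invK : involutive word_inv.
Proof.
move=> u; rewrite /word_inv map_rev revK -map_comp -[RHS]map_id.
by apply: eq_map => -[x b] /=; rewrite negbK.
Qed.

Lemma pres_word_inv u : pres_cong (u ++ word_inv u) [::].
Proof.
elim: u => [|[x b] u IHu]; first exact: pres_refl.
rewrite /word_inv /= rev_cons -cats1 -/(word_inv u) catA -cat_cons.
rewrite -(cat1s (x, b) (u ++ _)).
apply: (@pres_trans _ (([:: (x, b)] ++ [::]) ++ [:: (x, ~~ b)])).
  by apply: pres_cat (pres_refl _); apply: pres_cat (pres_refl _) _.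
exact: pres_cancel.
Qed.

Lemma pres_mulA : associative pres_mul.
Proof.
move=> f g h; rewrite -[f]pres_class_repr -[g]pres_class_repr -[h]pres_class_repr.
by rewrite !pres_mulE catA.
Qed.

Lemma pres_mul1 : left_id pres_one pres_mul.
Proof. by move=> g; rewrite -[g]pres_class_repr pres_mulE. Qed.

Lemma pres_1mul : right_id pres_one pres_mul.
Proof. by move=> g; rewrite -[g]pres_class_repr pres_mulE cats0. Qed.

Lemma pres_mulV : right_inverse pres_one pres_inv pres_mul.
Proof.
move=> g; rewrite -{1}[g]pres_class_repr pres_mulE.
exact/pres_classP/pres_word_inv.
Qed.

Lemma pres_mulVl : left_inverse pres_one pres_inv pres_mul.
Proof.
move=> g; rewrite -{2}[g]pres_class_repr pres_mulE.
by apply/pres_classP; rewrite -{2}[pres_repr g]word_invK; exact: pres_word_inv.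
Qed.

HB.instance Definition _ := isGroup.Build presented_group
  pres_mulA pres_mul1 pres_1mul pres_mulVl pres_mulV.

Definition pres_gen (x : X) : presented_group := pres_class [:: (x, true)].

End PresentedGroup.

Section GroupAlgebra.
Variables (k : comPzRingType) (G : groupType).

Definition galg : Type := {fsfun G -> k with 0}.
HB.instance Definition _ := Choice.on galg.

Implicit Types (f g h : galg) (S : {fset G}).

Definition gcoef f (x : G) : k := (f : {fsfun G -> k with 0}) x.

Definition galg_of S (F : G -> k) : galg := [fsfun x in S => F x | 0].

Lemma gcoefE S F x : gcoef (galg_of S F) x = if x \in S then F x else 0.
Proof. exact: fsfun_fun. Qed.

Lemma galgP f g : (forall x, gcoef f x = gcoef g x) <-> f = g.
Proof. exact: fsfunP. Qed.

Definition gsupp f : {fset G} := finsupp (f : {fsfun G -> k with 0}).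

Lemma gcoef_out f x : x \notin gsupp f -> gcoef f x = 0.
Proof. exact: fsfun_dflt. Qed.

Definition galg0 : galg := galg_of fset0 (fun=> 0).
Definition galg_opp f := galg_of (gsupp f) (fun x => - gcoef f x).
Definition galg_add f g :=
  galg_of (gsupp f `|` gsupp g)%fset (fun x => gcoef f x + gcoef g x).
Definition galg_scale (c : k) f := galg_of (gsupp f) (fun x => c * gcoef f x).
Definition galg_delta (x : G) : galg := galg_of [fset x]%fset (fun=> 1).
Definition galg_mul f g : galg :=
  galg_of [fset (x * y)%g | x in gsupp f, y in gsupp g]%fset
    (fun z => \sum_(x <- gsupp f) gcoef f x * gcoef g (x^-1 * z)%g).

Lemma gcoef0 x : gcoef galg0 x = 0.
Proof. by rewrite gcoefE in_fset0. Qed.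

Lemma gcoefN f x : gcoef (galg_opp f) x = - gcoef f x.
Proof. by rewrite gcoefE; case: ifPn => // /gcoef_out ->; rewrite oppr0. Qed.

Lemma gcoefD f g x : gcoef (galg_add f g) x = gcoef f x + gcoef g x.
Proof.
rewrite gcoefE in_fsetU; case: ifPn => //; rewrite negb_or => /andP[].
by move=> /gcoef_out -> /gcoef_out ->; rewrite addr0.
Qed.

Lemma gcoefZ c f x : gcoef (galg_scale c f) x = c * gcoef f x.
Proof. by rewrite gcoefE; case: ifPn => // /gcoef_out ->; rewrite mulr0. Qed.

Lemma gcoef_delta x y : gcoef (galg_delta x) y = (y == x)%:R.
Proof. by rewrite gcoefE in_fset1; case: eqP. Qed.

Lemma gsum_supp f (F : G -> k) S : (gsupp f `<=` S)%fset ->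
  \sum_(x <- gsupp f) gcoef f x * F x = \sum_(x <- S) gcoef f x * F x.
Proof.
move=> fS; apply: big_fset_incl => // x _ /gcoef_out ->; exact: mul0r.
Qed.

Lemma gcoefM f g z :
  gcoef (galg_mul f g) z = \sum_(x <- gsupp f) gcoef f x * gcoef g (x^-1 * z)%g.
Proof.
rewrite gcoefE; case: ifPn => // zS; rewrite big_seq big1 // => x xf.
suff /gcoef_out -> : (x^-1 * z)%g \notin gsupp g by rewrite mulr0.
apply: contra zS => xz; apply/imfset2P; exists x => //.
by exists (x^-1 * z)%g => //; rewrite mulVKg.
Qed.

Lemma gcoefMw f g z S : (gsupp f `<=` S)%fset ->
  gcoef (galg_mul f g) z = \sum_(x <- S) gcoef f x * gcoef g (x^-1 * z)%g.
Proof. by move=> fS; rewrite gcoefM (gsum_supp (fun x => gcoef g (x^-1 * z)%g) fS). Qed.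

Lemma galg_addA : associative galg_add.
Proof. by move=> f g h; apply/galgP => x; rewrite !gcoefD addrA. Qed.
Lemma galg_addC : commutative galg_add.
Proof. by move=> f g; apply/galgP => x; rewrite !gcoefD addrC. Qed.
Lemma galg_add0 : left_id galg0 galg_add.
Proof. by move=> f; apply/galgP => x; rewrite !gcoefD gcoef0 add0r. Qed.
Lemma galg_addN : left_inverse galg0 galg_opp galg_add.
Proof. by move=> f; apply/galgP => x; rewrite !gcoefD gcoef0 gcoefN addNr. Qed.

HB.instance Definition _ :=
  GRing.isZmodule.Build galg galg_addA galg_addC galg_add0 galg_addN.

Lemma galg_mulDl : left_distributive galg_mul +%R.
Proof.
move=> f g h; apply/galgP => z; rewrite [RHS]gcoefD.
set S := (gsupp f `|` gsupp g `|` gsupp (f + g)%R)%fset.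
rewrite !(@gcoefMw _ _ _ S) ?[S]/S.
- by rewrite -big_split; apply: eq_bigr => x _; rewrite gcoefD mulrDl.
- exact: fsubset_trans (fsubsetUr _ _) (fsubsetUl _ _).
- exact: fsubset_trans (fsubsetUl _ _) (fsubsetUl _ _).
- exact: fsubsetUr.
Qed.

Lemma galg_mulDr : right_distributive galg_mul +%R.
Proof.
move=> f g h; apply/galgP => z; rewrite [RHS]gcoefD !gcoefM -big_split.
by apply: eq_bigr => x _; rewrite gcoefD mulrDr.
Qed.

Lemma galg_mul1 : left_id (galg_delta 1%g) galg_mul.
Proof.
move=> f; apply/galgP => z; rewrite (@gcoefMw _ _ _ [fset 1%g]%fset).
  by rewrite big_seq_fset1 gcoef_delta eqxx mul1r invg1 mul1g.
apply/fsubsetP => x; apply: contraTT => xS.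
by rewrite memNfinsupp -/(gcoef _ x) gcoefE (negPf xS).
Qed.

Lemma galg_1mul : right_id (galg_delta 1%g) galg_mul.
Proof.
move=> f; apply/galgP => z; rewrite (@gcoefMw _ _ _ (z |` gsupp f)%fset); last first.
  exact: fsubsetUr.
rewrite (big_fsetD1 z) ?fset1U1 //= gcoef_delta mulVg eqxx mulr1.
rewrite big_seq big1 ?addr0 // => x; rewrite in_fsetD1 => /andP[xz _].
rewrite gcoef_delta; case: eqP => [|_]; last by rewrite mulr0.
move=> /(congr1 (fun w => x * w)%g); rewrite mulVKg mulg1 => zx.
by rewrite zx eqxx in xz.
Qed.

Lemma galg_mulA : associative galg_mul.
Proof.
move=> f g h; apply/galgP => z.
set S := [fset (x * y)%g | x in gsupp f, y in gsupp g]%fset.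
have fgS : (gsupp (galg_mul f g) `<=` S)%fset.
  apply/fsubsetP => x; apply: contraTT => xS.
  by rewrite memNfinsupp -/(gcoef _ x) gcoefE (negPf xS).
rewrite gcoefM (gcoefMw _ _ fgS).
under [RHS]eq_bigr do rewrite gcoefM mulr_suml.
rewrite exchange_big /=; apply: eq_big_seq => x xf.
under [RHS]eq_bigr do rewrite -mulrA.
rewrite -mulr_sumr; congr (_ * _).
set T := [fset (x^-1 * w)%g | w in S]%fset.
have gT : (gsupp g `<=` T)%fset.
  apply/fsubsetP => y yg; apply/imfsetP; exists (x * y)%g; last by rewrite mulKg.
  by apply/imfset2P; exists x => //; exists y.
rewrite (gcoefMw _ _ gT) big_imfset /=; last first.
  by move=> a b _ _ /mulgI.
by apply: eq_bigr => w _; rewrite invgM invgK -mulgA mulVKg.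
Qed.

HB.instance Definition _ := GRing.Zmodule_isPzRing.Build galg
  galg_mulA galg_mul1 galg_1mul galg_mulDl galg_mulDr.

Lemma galg_scaleA a b f : galg_scale a (galg_scale b f) = galg_scale (a * b) f.
Proof. by apply/galgP => x; rewrite !gcoefZ mulrA. Qed.
Lemma galg_scale1 : left_id 1 galg_scale.
Proof. by move=> f; apply/galgP => x; rewrite !gcoefZ mul1r. Qed.
Lemma galg_scaleDr : right_distributive galg_scale +%R.
Proof. by move=> a f g; apply/galgP => x; rewrite !(gcoefD, gcoefZ) mulrDr. Qed.
Lemma galg_scaleDl f : {morph galg_scale^~ f : a b / a + b}.
Proof. by move=> a b; apply/galgP => x; rewrite !(gcoefD, gcoefZ) mulrDl. Qed.

HB.instance Definition _ := GRing.Zmodule_isLmodule.Build k galg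
  galg_scaleA galg_scale1 galg_scaleDr galg_scaleDl.

(* MathComp's [algType] forces 1 != 0, so the compatibility of the product with
   scalars is stated by hand (here and for the quotient below). *)
Lemma galg_scaleAl (c : k) (f g : galg) : c *: (f * g) = (c *: f) * g.
Proof.
apply/galgP => z; rewrite [LHS]gcoefZ gcoefM.
have cf : (gsupp (c *: f) `<=` gsupp f)%fset.
  apply/fsubsetP => x; apply: contraTT => xf.
  by rewrite memNfinsupp -/(gcoef _ x) gcoefZ gcoef_out // mulr0.
rewrite (gcoefMw _ _ cf) mulr_sumr.
by apply: eq_bigr => x _; rewrite gcoefZ mulrA.
Qed.

Lemma galg_scaleAr (c : k) (f g : galg) : c *: (f * g) = f * (c *: g).
Proof.
apply/galgP => z; rewrite [LHS]gcoefZ !gcoefM mulr_sumr.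
by apply: eq_bigr => x _; rewrite gcoefZ mulrCA.
Qed.

Lemma galg_deltaM (x y : G) :
  galg_delta x * galg_delta y = galg_delta (x * y)%g.
Proof.
apply/galgP => z; rewrite [LHS](@gcoefMw _ _ _ [fset x]%fset).
  rewrite big_seq_fset1 !gcoef_delta eqxx mul1r; congr (_%:R).
  by rewrite -(inj_eq (mulgI x)) mulVKg.
apply/fsubsetP => w; apply: contraTT => wS.
by rewrite memNfinsupp -/(gcoef _ w) gcoefE (negPf wS).
Qed.

End GroupAlgebra.

Section GroupAlgebraQuotient.
Variables (k : comPzRingType) (G : groupType) (gens : set (galg k G)).

Inductive ideal_span : galg k G -> Prop :=
| ideal_span0 : ideal_span 0
| ideal_spanD a s b x :
    gens s -> ideal_span x -> ideal_span (a * s * b + x).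

Definition gideal : {pred galg k G} := fun x => `[< ideal_span x >].

Lemma ideal_span_add x y : ideal_span x -> ideal_span y -> ideal_span (x + y).
Proof.
move=> + Iy; elim=> [|a s b {}x ss _ IH]; first by rewrite add0r.
by rewrite -addrA; exact: ideal_spanD.
Qed.

Lemma ideal_span_mul a x b : ideal_span x -> ideal_span (a * x * b).
Proof.
elim=> [|a' s b' {}x ss _ IH]; first by rewrite mulr0 mul0r; exact: ideal_span0.
by rewrite mulrDr mulrDl !mulrA -[_ * b' * b]mulrA; exact: ideal_spanD.
Qed.

Lemma gideal_zmod : zmod_closed gideal.
Proof.
split=> [|x y /asboolP Ix /asboolP Iy]; apply/asboolP; first exact: ideal_span0.
apply: ideal_span_add => //.
by rewrite -[y]mulr1 -mulN1r mulrA; exact: ideal_span_mul.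
Qed.

HB.instance Definition _ := GRing.isZmodClosed.Build (galg k G) gideal gideal_zmod.

Definition gquot : Type := {ideal_quot gideal}.
HB.instance Definition _ := GRing.Zmodule.on gquot.

Definition gquot_pi (x : galg k G) : gquot := \pi_{ideal_quot gideal} x.

Lemma gquot_piP x y : gquot_pi x = gquot_pi y <-> ideal_span (x - y).
Proof.
split.
  move=> /eqP xy; apply/asboolP.
  by have := Quotient.idealrBE gideal x y; rewrite xy.
by move=> /asboolP xy; apply/eqP; have := Quotient.idealrBE gideal x y => <-.
Qed.

Lemma gquot_pi_repr (x : gquot) : gquot_pi (repr (x : {ideal_quot gideal})) = x.
Proof. exact: reprK. Qed.

Lemma gquot_piD x y : gquot_pi (x + y) = gquot_pi x + gquot_pi y.
Proof. exact: Quotient.pi_add. Qed.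

Definition gquot_repr (x : gquot) : galg k G := repr (x : {ideal_quot gideal}).

Lemma gquot_reprP x : ideal_span (gquot_repr (gquot_pi x) - x).
Proof. by apply/gquot_piP; exact: gquot_pi_repr. Qed.

Definition gquot_mul (x y : gquot) := gquot_pi (gquot_repr x * gquot_repr y).
Definition gquot_scale (c : k) (x : gquot) := gquot_pi (c *: gquot_repr x).

Lemma gquot_piM x y : gquot_mul (gquot_pi x) (gquot_pi y) = gquot_pi (x * y).
Proof.
apply/gquot_piP; set x' := gquot_repr _; set y' := gquot_repr _.
have -> : x' * y' - x * y = 1 * (x' - x) * y' + x * (y' - y) * 1.
  by rewrite mul1r mulr1 mulrBl mulrBr addrA subrK.
by apply: ideal_span_add; apply: ideal_span_mul; exact: gquot_reprP.
Qed.

Lemma gquot_piZ c x : gquot_scale c (gquot_pi x) = gquot_pi (c *: x).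
Proof.
apply/gquot_piP; rewrite -scalerBr -[X in c *: X]mul1r galg_scaleAl.
by rewrite -[_ * _]mulr1; apply: ideal_span_mul; exact: gquot_reprP.
Qed.

Lemma gquot_ind (P : gquot -> Prop) : (forall x, P (gquot_pi x)) -> forall x, P x.
Proof. by move=> PP x; rewrite -[x]gquot_pi_repr. Qed.

Lemma gquot_mulA : associative gquot_mul.
Proof.
by elim/gquot_ind=> x; elim/gquot_ind=> y; elim/gquot_ind=> z; rewrite !gquot_piM mulrA.
Qed.
Lemma gquot_mul1 : left_id (gquot_pi 1) gquot_mul.
Proof. by elim/gquot_ind=> x; rewrite gquot_piM mul1r. Qed.
Lemma gquot_1mul : right_id (gquot_pi 1) gquot_mul.
Proof. by elim/gquot_ind=> x; rewrite gquot_piM mulr1. Qed.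
Lemma gquot_mulDl : left_distributive gquot_mul +%R.
Proof.
elim/gquot_ind=> x; elim/gquot_ind=> y; elim/gquot_ind=> z.
by rewrite -gquot_piD !gquot_piM mulrDl gquot_piD.
Qed.
Lemma gquot_mulDr : right_distributive gquot_mul +%R.
Proof.
elim/gquot_ind=> x; elim/gquot_ind=> y; elim/gquot_ind=> z.
by rewrite -gquot_piD !gquot_piM mulrDr gquot_piD.
Qed.

HB.instance Definition _ := GRing.Zmodule_isPzRing.Build gquot
  gquot_mulA gquot_mul1 gquot_1mul gquot_mulDl gquot_mulDr.

Lemma gquot_scaleA a b x : gquot_scale a (gquot_scale b x) = gquot_scale (a * b) x.
Proof. by elim/gquot_ind: x => x; rewrite !gquot_piZ scalerA. Qed.
Lemma gquot_scale1 : left_id 1 gquot_scale.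
Proof. by elim/gquot_ind=> x; rewrite gquot_piZ scale1r. Qed.
Lemma gquot_scaleDr : right_distributive gquot_scale +%R.
Proof.
move=> a; elim/gquot_ind=> x; elim/gquot_ind=> y.
by rewrite -gquot_piD !gquot_piZ scalerDr gquot_piD.
Qed.
Lemma gquot_scaleDl x : {morph gquot_scale^~ x : a b / a + b}.
Proof.
by move=> a b; elim/gquot_ind: x => x; rewrite !gquot_piZ scalerDl gquot_piD.
Qed.

HB.instance Definition _ := GRing.Zmodule_isLmodule.Build k gquot
  gquot_scaleA gquot_scale1 gquot_scaleDr gquot_scaleDl.

Lemma gquot_mulE x y : gquot_pi x * gquot_pi y = gquot_pi (x * y).
Proof. exact: gquot_piM. Qed.

Lemma gquot_scaleE (c : k) x : c *: gquot_pi x = gquot_pi (c *: x).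
Proof. exact: gquot_piZ. Qed.

Lemma gquot_scaleAl (c : k) (x y : gquot) : c *: (x * y) = (c *: x) * y.
Proof.
elim/gquot_ind: x => x; elim/gquot_ind: y => y.
by rewrite gquot_mulE !gquot_scaleE gquot_mulE galg_scaleAl.
Qed.

Lemma gquot_scaleAr (c : k) (x y : gquot) : c *: (x * y) = x * (c *: y).
Proof.
elim/gquot_ind: x => x; elim/gquot_ind: y => y.
by rewrite gquot_mulE !gquot_scaleE gquot_mulE galg_scaleAr.
Qed.

End GroupAlgebraQuotient.

(* Xup and Xlow are the character and cocharacter lattices X^* and X_*.  The dual
   bases [cobasis], [basis] say that the lattices are free of finite
   rank and that the pairing is perfect; [basis] is also used below to write
   Xlow (x) R as a space of column vectors.  Roots are indexed by a finite type,
   and [root_of a |-> coroot_of a] is the bijection between roots and coroots. *)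
Record based_root_datum := BasedRootDatum {
  Xup : zmodType;
  Xlow : zmodType;
  pairing : Xup -> Xlow -> int;
  pairingDl : forall x x' y, pairing (x + x') y = pairing x y + pairing x' y;
  pairingDr : forall x y y', pairing x (y + y') = pairing x y + pairing x y';
  lat_rank : nat;
  cobasis : 'I_lat_rank -> Xup;
  basis : 'I_lat_rank -> Xlow;
  pairing_dual : forall i j, pairing (cobasis i) (basis j) = (i == j)%:R;
  cobasisP : forall x, x = \sum_i cobasis i *~ pairing x (basis i);
  basisP : forall y, y = \sum_i basis i *~ pairing (cobasis i) y;
  root_idx : finType;
  root_of : root_idx -> Xup;
  coroot_of : root_idx -> Xlow;
  root_inj : injective root_of;
  coroot_inj : injective coroot_of;
  pairing_coroot : forall a, pairing (root_of a) (coroot_of a) = 2;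
  refl_root : forall a b, exists c,
    root_of c = root_of b - root_of a *~ pairing (root_of b) (coroot_of a);
  refl_coroot : forall a b, exists c,
    coroot_of c = coroot_of b - coroot_of a *~ pairing (root_of a) (coroot_of b);
  ss_rank : nat;
  simple_idx : 'I_ss_rank -> root_idx;
  simple_free : forall c : 'I_ss_rank -> int,
    \sum_i root_of (simple_idx i) *~ c i = 0 -> forall i, c i = 0;
  simple_span : forall a, exists c : 'I_ss_rank -> nat,
    root_of a = \sum_i root_of (simple_idx i) *+ c i \/
    root_of a = - \sum_i root_of (simple_idx i) *+ c i
}.

Section RootDatum.
Variable D : based_root_datum.

Definition reduced : Prop := forall (a b : root_idx D) (m n : int),
  m != 0 -> root_of b *~ m = root_of a *~ n ->
  root_of b = root_of a \/ root_of b = - root_of a.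

Definition irreducible : Prop :=
  inhabited (root_idx D) /\
  forall P : pred (root_idx D),
    (forall a b, P a -> ~~ P b -> pairing (root_of a) (coroot_of b) = 0) ->
    (forall a, P a) \/ (forall a, ~~ P a).

Definition nneg_comb (x : Xup D) : bool :=
  `[< exists c : 'I_(ss_rank D) -> nat, x = \sum_i root_of (simple_idx i) *+ c i >].

Definition positive (a : root_idx D) : bool := nneg_comb (root_of a).

Definition highest_root (a0 : root_idx D) : Prop :=
  forall b, nneg_comb (root_of a0 - root_of b).

Definition dominant (y : Xlow D) : Prop :=
  forall a, positive a -> 0 <= pairing (root_of a) y.

Definition refl_up (a : root_idx D) (x : Xup D) : Xup D :=
  x - root_of a *~ pairing x (coroot_of a).
Definition refl_low (a : root_idx D) (y : Xlow D) : Xlow D :=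
  y - coroot_of a *~ pairing (root_of a) y.

(* The group generated by the root reflections, an element being given by its
   two (mutually contragredient) actions on Xup and on Xlow.  As reflections are
   involutions, closure under products suffices. *)
Inductive in_weyl : (Xup D -> Xup D) -> (Xlow D -> Xlow D) -> Prop :=
| in_weyl1 : in_weyl id id
| in_weyl_refl a f g :
    in_weyl f g -> in_weyl (refl_up a \o f) (refl_low a \o g).

Record weyl := Weyl {
  act_up : Xup D -> Xup D;
  act_low : Xlow D -> Xlow D;
  weylP : in_weyl act_up act_low
}.

HB.instance Definition _ := gen_eqMixin weyl.
HB.instance Definition _ := gen_choiceMixin weyl.

Lemma weyl_eq (w w' : weyl) :
  act_up w = act_up w' -> act_low w = act_low w' -> w = w'.
Proof.
case: w w' => [f g P] [f' g' P'] /= ef eg; subst f' g'.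
by rewrite (Prop_irrelevance P P').
Qed.

Lemma pairing0l y : pairing (0 : Xup D) y = 0.
Proof. by apply: (addrI (pairing 0 y)); rewrite -pairingDl !addr0. Qed.
Lemma pairing0r x : pairing x (0 : Xlow D) = 0.
Proof. by apply: (addrI (pairing x 0)); rewrite -pairingDr !addr0. Qed.
Lemma pairingNl (x : Xup D) y : pairing (- x) y = - pairing x y.
Proof. by apply: (addrI (pairing x y)); rewrite -pairingDl !subrr pairing0l. Qed.
Lemma pairingNr (x : Xup D) y : pairing x (- y) = - pairing x y.
Proof. by apply: (addrI (pairing x y)); rewrite -pairingDr !subrr pairing0r. Qed.
Lemma pairingMzl (x : Xup D) y n : pairing (x *~ n) y = pairing x y * n.
Proof.
have nat_case (m : nat) : pairing (x *+ m) y = pairing x y *+ m.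
  by elim: m => [|m IHm]; rewrite ?mulr0n ?pairing0l // !mulrS pairingDl IHm.
case: n => n; first by rewrite -pmulrn nat_case pmulrn mulrzz.
by rewrite NegzE mulrNz pairingNl -pmulrn nat_case pmulrn mulrzz mulrN.
Qed.
Lemma pairingMzr (x : Xup D) y n : pairing x (y *~ n) = pairing x y * n.
Proof.
have nat_case (m : nat) : pairing x (y *+ m) = pairing x y *+ m.
  by elim: m => [|m IHm]; rewrite ?mulr0n ?pairing0r // !mulrS pairingDr IHm.
case: n => n; first by rewrite -pmulrn nat_case pmulrn mulrzz.
by rewrite NegzE mulrNz pairingNr -pmulrn nat_case pmulrn mulrzz mulrN.
Qed.

Lemma refl_upK a : involutive (refl_up a).
Proof.
move=> x; rewrite /refl_up pairingDl pairingNl pairingMzl pairing_coroot.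
by rewrite mulrC mulr_natr mulr2n opprD addrA subrr add0r mulrNz opprK subrK.
Qed.

Lemma refl_lowK a : involutive (refl_low a).
Proof.
move=> y; rewrite /refl_low pairingDr pairingNr pairingMzr pairing_coroot.
by rewrite mulrC mulr_natr mulr2n opprD addrA subrr add0r mulrNz opprK subrK.
Qed.

Lemma in_weyl_comp f g f' g' :
  in_weyl f g -> in_weyl f' g' -> in_weyl (f \o f') (g \o g').
Proof. by move=> + W'; elim=> [|a f1 g1 _ IH] //; exact: in_weyl_refl IH. Qed.

Lemma in_weyl_inv f g : in_weyl f g ->
  exists f' g', [/\ in_weyl f' g', f' \o f = id & g' \o g = id].
Proof.
elim=> [|a f1 g1 _ [f' [g' [W' ff' gg']]]]; first by exists id, id; split=> //; exact: in_weyl1.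
exists (f' \o refl_up a), (g' \o refl_low a); split.
- exact: in_weyl_comp W' (in_weyl_refl a in_weyl1).
- by apply/funext => x /=; rewrite refl_upK -[RHS](congr1 (@^~ x) ff').
- by apply/funext => y /=; rewrite refl_lowK -[RHS](congr1 (@^~ y) gg').
Qed.

Definition weyl_one : weyl := Weyl in_weyl1.
Definition weyl_mul (w w' : weyl) : weyl := Weyl (in_weyl_comp (weylP w) (weylP w')).

Lemma weyl_inv_ex (w : weyl) : exists w' : weyl, weyl_mul w' w = weyl_one.
Proof.
have [f [g [W fw gw]]] := in_weyl_inv (weylP w).
by exists (Weyl W); apply: weyl_eq.
Qed.

Definition weyl_inv (w : weyl) : weyl := projT1 (cid (weyl_inv_ex w)).

Lemma weyl_mulA : associative weyl_mul.
Proof. by move=> u v w; apply: weyl_eq. Qed.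
Lemma weyl_mul1 : left_id weyl_one weyl_mul.
Proof. by move=> w; apply: weyl_eq. Qed.
Lemma weyl_1mul : right_id weyl_one weyl_mul.
Proof. by move=> w; apply: weyl_eq. Qed.
Lemma weyl_mulV : left_inverse weyl_one weyl_inv weyl_mul.
Proof. by move=> w; rewrite /weyl_inv; case: cid. Qed.
Lemma weyl_mulVr : right_inverse weyl_one weyl_inv weyl_mul.
Proof.
move=> w; rewrite -[LHS]weyl_mul1 -{1}(weyl_mulV (weyl_inv w)) -!weyl_mulA.
by rewrite [weyl_mul _ (weyl_mul w _)]weyl_mulA weyl_mulV weyl_mul1 weyl_mulV.
Qed.

HB.instance Definition _ := isGroup.Build weyl
  weyl_mulA weyl_mul1 weyl_1mul weyl_mulV weyl_mulVr.

Definition refl (a : root_idx D) : weyl := Weyl (in_weyl_refl a in_weyl1).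

Lemma act_lowD (w : weyl) : {morph act_low w : y y' / y + y'}.
Proof.
case: w => f g /=; elim=> [|a f1 g1 _ IH] y y' //=.
by rewrite IH /refl_low pairingDr mulrzDr opprD addrACA.
Qed.

Lemma act_lowM (w w' : weyl) y : act_low (w * w')%g y = act_low w (act_low w' y).
Proof. by []. Qed.

Lemma act_low1 y : act_low 1%g y = y.
Proof. by []. Qed.

(* [ExtWeyl y w] is the element eps^y w of the semidirect product. *)
Record ext_weyl := ExtWeyl { transl : Xlow D; linpart : weyl }.

HB.instance Definition _ := gen_eqMixin ext_weyl.
HB.instance Definition _ := gen_choiceMixin ext_weyl.

Definition ext_one : ext_weyl := ExtWeyl 0 1%g.
Definition ext_mul (x y : ext_weyl) : ext_weyl :=
  ExtWeyl (transl x + act_low (linpart x) (transl y)) (linpart x * linpart y)%g.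
Definition ext_inv (x : ext_weyl) : ext_weyl :=
  ExtWeyl (- act_low (linpart x)^-1%g (transl x)) (linpart x)^-1%g.

Lemma act_low0 (w : weyl) : act_low w 0 = 0.
Proof. by apply: (addrI (act_low w 0)); rewrite -act_lowD !addr0. Qed.
Lemma act_lowN (w : weyl) y : act_low w (- y) = - act_low w y.
Proof. by apply: (addrI (act_low w y)); rewrite -act_lowD !subrr act_low0. Qed.

Lemma ext_mulA : associative ext_mul.
Proof. by move=> x y z; rewrite /ext_mul /= act_lowD addrA mulgA. Qed.
Lemma ext_mul1 : left_id ext_one ext_mul.
Proof. by case=> y w; rewrite /ext_mul /= add0r mul1g. Qed.
Lemma ext_1mul : right_id ext_one ext_mul.
Proof. by case=> y w; rewrite /ext_mul /= act_low0 addr0 mulg1. Qed.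
Lemma ext_mulV : left_inverse ext_one ext_inv ext_mul.
Proof. by case=> y w; rewrite /ext_mul /= addNr mulVg. Qed.
Lemma ext_mulVr : right_inverse ext_one ext_inv ext_mul.
Proof. by case=> y w; rewrite /ext_mul /= act_lowN -act_lowM mulgV subrr. Qed.

HB.instance Definition _ := isGroup.Build ext_weyl
  ext_mulA ext_mul1 ext_1mul ext_mulV ext_mulVr.

Definition eps (y : Xlow D) : ext_weyl := ExtWeyl y 1%g.
Definition fin (w : weyl) : ext_weyl := ExtWeyl 0 w.

(* x = w eps^y with w = linpart x and y = w^-1 (transl x). *)
Definition ext_len (x : ext_weyl) : nat :=
  let w := linpart x in
  let y := act_low w^-1%g (transl x) in
  (\sum_(a | positive a && nneg_comb (- act_up w (root_of a))%R)
      absz (pairing (root_of a) y + 1)%R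
   + \sum_(a | positive a && nneg_comb (act_up w (root_of a)))
      absz (pairing (root_of a) y))%N.

(* Index 0 is the affine reflection, index i.+1 the i-th simple one. *)
Definition affrefl (a0 : root_idx D) (i : 'I_(ss_rank D).+1) : ext_weyl :=
  if unlift ord0 i is Some j then fin (refl (simple_idx j))
  else (eps (coroot_of a0) * fin (refl a0))%g.

Section Alcoves.
Variable R : realType.

(* X_{*,R} in the coordinates given by [basis D]. *)
Local Notation V := 'cV[R]_(lat_rank D).

Definition pairingR (x : Xup D) (p : V) : R :=
  \sum_j (pairing x (basis j))%:~R * p j 0.

Definition lowR (y : Xlow D) : V := \col_i (pairing (cobasis i) y)%:~R.

Definition act_lowR (w : weyl) (p : V) : V :=
  \sum_j p j 0 *: lowR (act_low w (basis j)).

Definition ext_act (x : ext_weyl) (p : V) : V :=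
  act_lowR (linpart x) p + lowR (transl x).

Definition hyperplane (a : root_idx D) (n : int) : set V :=
  [set p | pairingR (root_of a) p = n%:~R].

Definition off_hyperplanes : set V :=
  ~` (\bigcup_(a in [set: root_idx D]) \bigcup_(n in [set: int]) hyperplane a n).

Definition alcove (A : set V) : Prop :=
  exists2 p, off_hyperplanes p & A = connected_component off_hyperplanes p.

Definition dominant_chamber : set V :=
  [set p | forall a, positive a -> 0 < pairingR (root_of a) p].

Definition base_alcove (A : set V) : Prop :=
  [/\ alcove A, A `<=` dominant_chamber & closure A 0].

Definition wall (a0 : root_idx D) (x : ext_weyl) (i : 'I_(ss_rank D).+1) : set V :=
  ext_act x @` [set p | ext_act (affrefl a0 i) p = p].

Definition on_negative_side (a0 : root_idx D) (A : set V) (x : ext_weyl)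
    (i : 'I_(ss_rank D).+1) : Prop :=
  exists (a : root_idx D) (j : int),
    [/\ positive a, wall a0 x i = hyperplane a j &
        ext_act x @` A `<=` [set p | pairingR (root_of a) p < j%:~R]].

(* x A does not meet the wall, so it is on the positive side if it is not on the
   negative one. *)
Definition wall_sign (a0 : root_idx D) (A : set V) (x : ext_weyl)
    (i : 'I_(ss_rank D).+1) : int :=
  if `[< on_negative_side a0 A x i >] then 1 else -1.

Definition word_sign (a0 : root_idx D) (A : set V) (k : nat)
    (i : 'I_k -> 'I_(ss_rank D).+1) (nu : 'I_k) : int :=
  wall_sign a0 A (\prod_(mu < k | (mu < nu)%N) affrefl a0 (i mu))%g (i nu).

End Alcoves.

Definition braid_rels (u v : seq (ext_weyl * bool)) : Prop :=
  exists x y : ext_weyl,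
    [/\ ext_len (x * y)%g = (ext_len x + ext_len y)%N,
        u = [:: (x, true); (y, true)] & v = [:: ((x * y)%g, true)]].

Definition braid_group := presented_group braid_rels.
HB.instance Definition _ := Group.on braid_group.

Definition braid_gen (x : ext_weyl) : braid_group := pres_gen braid_rels x.

Section Hecke.
Variables (a0 : root_idx D) (k0 : comPzRingType).

Local Notation delta g := (galg_delta k0 (g : braid_group)).

Definition quadratic_rels (q : k0) : set (galg k0 braid_group) :=
  [set (delta (braid_gen (affrefl a0 i)) + 1) *
       (delta (braid_gen (affrefl a0 i)) - q *: (1 : galg k0 braid_group)) |
       i in [set: 'I_(ss_rank D).+1]].

Definition hecke (q : k0) : Type := gquot (quadratic_rels q).
HB.instance Definition _ q := GRing.PzRing.on (hecke q).
HB.instance Definition _ q := GRing.Lmodule.on (hecke q).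

(* q = v ^+ 2, and u stands for the inverse of v. *)
Variables (v u : k0).

Definition hecke_of (g : braid_group) : hecke (v ^+ 2) := gquot_pi _ (delta g).

Definition Ttil (x : ext_weyl) : hecke (v ^+ 2) :=
  u ^+ ext_len x *: hecke_of (braid_gen x).
(* The inverse of [Ttil x], see [TtilK] below. *)
Definition TtilV (x : ext_weyl) : hecke (v ^+ 2) :=
  v ^+ ext_len x *: hecke_of (braid_gen x)^-1%g.

Definition Ttil_exp (x : ext_weyl) (e : int) : hecke (v ^+ 2) :=
  match e with Posz n => Ttil x ^+ n | Negz n => TtilV x ^+ n.+1 end.

(* An arbitrary choice: [Theta] does not depend on it. *)
Definition dominant_pair (y : Xlow D) : Xlow D * Xlow D :=
  xget (0, 0) [set p | [/\ dominant p.1, dominant p.2 & y = p.1 - p.2]].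

Definition Theta (y : Xlow D) : hecke (v ^+ 2) :=
  Ttil (eps (dominant_pair y).1) * TtilV (eps (dominant_pair y).2).

Lemma TtilK x : v * u = 1 -> Ttil x * TtilV x = 1 /\ TtilV x * Ttil x = 1.
Proof.
move=> vu; rewrite /Ttil /TtilV /hecke_of; split.
  rewrite -[LHS]gquot_scaleAl -gquot_scaleAr gquot_mulE galg_deltaM mulgV scalerA.
  by rewrite -exprMn mulrC vu expr1n scale1r.
rewrite -[LHS]gquot_scaleAl -gquot_scaleAr gquot_mulE galg_deltaM mulVg scalerA.
by rewrite -exprMn vu expr1n scale1r.
Qed.

End Hecke.
End RootDatum.

(* Main.v *)
(* For mu deep in the dominant chamber, the walk mu a, mu x_1 a, mu x_2 a, ... crosses
   each wall away from or towards the base alcove a exactly according to the sign of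
   the standard orientation, so each step multiplies T(eps^mu x_nu) by T_i or T_i^-1.
   Hence T(eps^mu) times the signed product is T(eps^(mu + lam)).  As lengths add on
   dominant translations, T(eps^mu) Theta_lam = T(eps^(mu + lam)) as well. *)
Require Import Defs.
From HB Require Import structures.
From mathcomp Require Import all_boot all_order all_algebra.
From mathcomp Require Import finmap.
From mathcomp Require Import boolp classical_sets functions reals topology normedtype.
From mathcomp Require Import zify ring lra.

Set Implicit Arguments.
Unset Strict Implicit.
Unset Printing Implicit Defensive.

Import Order.TTheory GRing.Theory Num.Theory.
Import numFieldNormedType.Exports.

Local Open Scope classical_set_scope.
Local Open Scope ring_scope.

(** * Roots and the finite Weyl group *)

Section Roots.
Variable D : based_root_datum.
Implicit Types (x : Xup D) (y : Xlow D) (a b : root_idx D) (w : weyl D).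

Lemma nneg_combD x x' : nneg_comb x -> nneg_comb x' -> nneg_comb (x + x').
Proof.
move=> /asboolP[c ->] /asboolP[d ->]; apply/asboolP.
exists (fun i => (c i + d i)%N); rewrite -big_split.
by apply: eq_bigr => i _; rewrite mulrnDr.
Qed.

Lemma nneg_combMn x n : nneg_comb x -> nneg_comb (x *+ n).
Proof.
move=> xp; elim: n => [|n IHn]; last by rewrite mulrS nneg_combD.
by apply/asboolP; exists (fun=> 0%N); rewrite mulr0n big1.
Qed.

(** The two expansions add up to a vanishing combination of simple roots, so linear independence
    kills all coefficients. *)
Lemma nneg_comb_anti x : nneg_comb x -> nneg_comb (- x) -> x = 0.
Proof.
move=> /asboolP[c xc] /asboolP[d xd].
have /simple_free cd0 : \sum_i root_of (simple_idx i) *~ ((c i)%:Z + (d i)%:Z) = 0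
    :> Xup D.
  under eq_bigr do rewrite mulrzDr -!pmulrn.
  by rewrite big_split /= -xc -xd subrr.
by rewrite xc big1 // => i _; have := cd0 i; case: (c i).
Qed.

Lemma root_neq0 a : root_of a != 0.
Proof.
by apply/eqP => a0; have := pairing_coroot a; rewrite a0 pairing0l.
Qed.

Lemma root_sign a : positive a \/ nneg_comb (- root_of a).
Proof.
have [c [ac|ac]] := simple_span a; [left|right]; apply/asboolP; exists c => //.
by rewrite ac opprK.
Qed.

Lemma nneg_comb_opp_root a : nneg_comb (- root_of a) = ~~ positive a.
Proof.
apply/idP/idP; last by case: (root_sign a) => [->|].
by apply: contraTN => ap; apply: contra (root_neq0 a) => /(nneg_comb_anti ap) ->.
Qed.

Lemma opp_root_ex a : exists c, root_of c = - root_of a.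
Proof.
have [c cE] := refl_root a a; exists c.
by rewrite cE pairing_coroot -pmulrn mulr2n opprD addrA subrr add0r.
Qed.

(** Negation, and below the Weyl action, are lifted to root indices; [root_inj] makes the chosen
    index unique. *)
Definition opp_root a := projT1 (cid (opp_root_ex a)).

Lemma opp_rootE a : root_of (opp_root a) = - root_of a.
Proof. by rewrite /opp_root; case: cid. Qed.

Lemma opp_rootK : involutive opp_root.
Proof. by move=> a; apply: root_inj; rewrite !opp_rootE opprK. Qed.

Lemma positive_opp_root a : positive (opp_root a) = ~~ positive a.
Proof. by rewrite /positive opp_rootE nneg_comb_opp_root. Qed.

Lemma act_up_root_ex w a : exists c, root_of c = act_up w (root_of a).
Proof.
case: w => f g /=; elim=> [|b f1 g1 _ [c fc]]; first by exists a.
by have [c' c'E] := refl_root b c; exists c'; rewrite /= -fc.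
Qed.

Definition act_root w a := projT1 (cid (act_up_root_ex w a)).

Lemma act_rootE w a : root_of (act_root w a) = act_up w (root_of a).
Proof. by rewrite /act_root; case: cid. Qed.

Lemma act_root1 a : act_root 1%g a = a.
Proof. by apply: root_inj; rewrite act_rootE. Qed.

Lemma act_rootM w w' a : act_root (w * w')%g a = act_root w (act_root w' a).
Proof. by apply: root_inj; rewrite !act_rootE. Qed.

Lemma act_rootK w : cancel (act_root w) (act_root w^-1%g).
Proof. by move=> a; rewrite -act_rootM mulVg act_root1. Qed.

Lemma act_rootVK w : cancel (act_root w^-1%g) (act_root w).
Proof. by move=> a; rewrite -act_rootM mulgV act_root1. Qed.

Lemma pairing_act w x y : pairing (act_up w x) (act_low w y) = pairing x y.
Proof.
case: w => f g /= fg; elim: fg x y => [|a f1 g1 _ IH] x y //=.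
rewrite /refl_up /refl_low !(pairingDl, pairingDr, pairingNl, pairingNr).
rewrite !(pairingMzl, pairingMzr) pairing_coroot IH.
ring.
Qed.

Lemma act_upN w x : act_up w (- x) = - act_up w x.
Proof.
case: w => f g /= fg; elim: fg x => [|a f1 g1 _ IH] x //=.
by rewrite IH /refl_up pairingNl mulrNz opprD.
Qed.

Lemma act_root_opp w a : act_root w (opp_root a) = opp_root (act_root w a).
Proof. by apply: root_inj; rewrite !(act_rootE, opp_rootE) act_upN. Qed.

Lemma pairing_actV w x y : pairing (act_up w x) y = pairing x (act_low w^-1%g y).
Proof. by rewrite -(pairing_act w^-1%g) -[act_up _ _]/(act_up (w^-1 * w)%g x) mulVg. Qed.

Lemma pairing_act_root w a y :
  pairing (root_of (act_root w^-1%g a)) y = pairing (root_of a) (act_low w y).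
Proof. by rewrite act_rootE pairing_actV invgK. Qed.

Lemma refl_mul a : (refl a * refl a)%g = 1%g.
Proof.
by apply: weyl_eq; apply/funext => z /=; rewrite ?refl_upK ?refl_lowK.
Qed.

Lemma refl_inv a : (refl a)^-1%g = refl a.
Proof. by apply: (mulgI (refl a)); rewrite mulgV refl_mul. Qed.

End Roots.

(** * Hyperplane crossings and length *)

Section Length.
Variable D : based_root_datum.
Implicit Types (a b : root_idx D) (w : weyl D) (x y : ext_weyl D).

(* The difference of floor <b, .> on the alcoves x a and a, hence up to sign the
   number of hyperplanes H_{b,n} separating them. *)
Definition crossing x b : int :=
  pairing (root_of b) (transl x)
  - (~~ positive (act_root (linpart x)^-1%g b))%:Z + (~~ positive b)%:Z.

(** A cocycle identity: the way from the base alcove to its image under [x * y] is cut at its image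
    under [x], and the second part is carried back by [x]. *)
Lemma crossingM x y b :
  crossing (x * y)%g b = crossing x b + crossing y (act_root (linpart x)^-1%g b).
Proof.
rewrite /crossing /= pairingDr -pairing_act_root invgM act_rootM.
by move: (~~ _ : nat) (~~ _ : nat) (~~ _ : nat) => m n p; lia.
Qed.

Lemma crossing_opp x b : crossing x (opp_root b) = - crossing x b.
Proof.
rewrite /crossing act_root_opp !positive_opp_root opp_rootE pairingNl.
by case: (positive _); case: (positive _) => /=; lia.
Qed.

Lemma crossing_eps (y : Xlow D) b : crossing (eps y) b = pairing (root_of b) y.
Proof. by rewrite /crossing invg1 act_root1 subrK. Qed.

(** Substitute [b = w a] when [w a] is positive and [b = - w a] otherwise; in the second case the
    negativity of [w a] supplies the [+ 1]. *)
Lemma ext_lenE x : ext_len x = (\sum_(b | positive b) `|crossing x b|)%N.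
Proof.
rewrite /ext_len; set w := linpart x; rewrite addnC.
rewrite [RHS](bigID (fun b => positive (act_root w^-1%g b))) /=.
congr (_ + _)%N.
  rewrite [RHS](reindex_onto (act_root w) (act_root w^-1%g)) /=; last first.
    by move=> b _; rewrite act_rootVK.
  apply: eq_big => a.
    by rewrite act_rootK eqxx andbT -act_rootE -/(positive _) andbC.
  move=> /andP[ap wap]; rewrite /crossing act_rootK ap -/w.
  rewrite -act_rootE -/(positive _) in wap.
  by rewrite wap subr0 addr0 act_rootE pairing_actV.
rewrite [RHS](reindex_onto (@opp_root D \o act_root w)
    (act_root w^-1%g \o @opp_root D)) /=; last first.
  by move=> b _; rewrite act_rootVK opp_rootK.
apply: eq_big => a.
  rewrite opp_rootK act_root_opp act_rootK eqxx andbT !positive_opp_root negbK.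
  by rewrite -act_rootE nneg_comb_opp_root andbC.
rewrite -act_rootE nneg_comb_opp_root => /andP[ap wan].
rewrite crossing_opp abszN /crossing act_rootK ap -/w wan subr0.
by rewrite act_rootE pairing_actV.
Qed.

Lemma ext_len_dominantD (y y' : Xlow D) : dominant y -> dominant y' ->
  ext_len (eps (y + y')) = (ext_len (eps y) + ext_len (eps y'))%N.
Proof.
move=> yd yd'; rewrite !ext_lenE -big_split; apply: eq_bigr => b bp.
have := yd _ bp; have := yd' _ bp; rewrite !crossing_eps pairingDr.
by move: (pairing _ _) (pairing _ _) => m n /= m0 n0; lia.
Qed.

Lemma epsD (y y' : Xlow D) : eps (y + y') = (eps y * eps y')%g.
Proof. by congr ExtWeyl; rewrite ?mulg1. Qed.

Lemma ext_len0_crossing x b : ext_len x = 0%N -> crossing x b = 0.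
Proof.
move=> /eqP; rewrite ext_lenE sum_nat_eq0 => /forallP x0.
have [bp|bn] := boolP (positive b).
  by apply/eqP; rewrite -absz_eq0; have := x0 b; rewrite bp.
have := x0 (opp_root b); rewrite positive_opp_root bn crossing_opp abszN absz_eq0.
by move/eqP.
Qed.

Lemma ext_len_mul0 x y : ext_len y = 0%N -> ext_len (x * y)%g = ext_len x.
Proof.
move=> y0; rewrite !ext_lenE; apply: eq_bigr => b _.
by rewrite crossingM (ext_len0_crossing _ y0) addr0.
Qed.

(* s is the reflection in a wall of the base alcove with inward gradient b. *)
Definition is_simple_refl (s : ext_weyl D) b :=
  [/\ (s * s)%g = 1%g, crossing s b = -1 &
      forall a, a <> b -> a <> opp_root b -> crossing s a = 0].

(** By the cocycle identity, passing to [x * s] changes the crossing only at [c], where it drops by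
    1, and at the opposite root. The absolute value decreases exactly when the crossing was
    positive. *)
Lemma ext_len_mul_simple x s b : is_simple_refl s b ->
  if 0 < crossing x (act_root (linpart x) b)
  then ext_len x = (ext_len (x * s)%g).+1 else ext_len (x * s)%g = (ext_len x).+1.
Proof.
move=> [_ sb s0]; set c := act_root _ b.
have bE : act_root (linpart x)^-1%g c = b by rewrite act_rootK.
(* The length is a sum over positive roots, so [c] enters it through whichever of [c] and its
   opposite is positive. *)
pose d := if positive c then c else opp_root c.
have dp : positive d.
  by rewrite /d; case: ifPn => // cn; rewrite positive_opp_root.
have absd y : `|crossing y d|%N = `|crossing y c|%N.
  by rewrite /d; case: ifP => // _; rewrite crossing_opp abszN.
have rest : (\sum_(a | positive a && (a != d)) `|crossing (x * s)%g a| =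
             \sum_(a | positive a && (a != d)) `|crossing x a|)%N.
  apply: eq_bigr => a /andP[ap ad]; rewrite crossingM s0 ?addr0 //.
    move=> ab; move: ad; rewrite /d; have -> : c = a by rewrite /c -ab act_rootVK.
    by rewrite ap eqxx.
  move=> ab; move: ad; rewrite /d; have -> : c = opp_root a.
    by rewrite /c -[b]opp_rootK -ab act_root_opp act_rootVK.
  by rewrite positive_opp_root ap opp_rootK eqxx.
rewrite !ext_lenE !(bigD1 d dp) /= rest !absd crossingM bE sb.
by case: ifP; lia.
Qed.

Lemma ext_len1 : ext_len (1%g : ext_weyl D) = 0%N.
Proof.
by rewrite ext_lenE big1 // => b _; rewrite -[1%g]/(eps 0) crossing_eps pairing0r.
Qed.

Lemma ext_len_simple s b : is_simple_refl s b -> ext_len s = 1%N.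
Proof.
move=> /(ext_len_mul_simple 1%g); rewrite mul1g ext_len1.
by rewrite -[1%g]/(eps 0) crossing_eps pairing0r.
Qed.

End Length.

(** * Simple affine reflections and the highest root *)

Section AffineSimple.
Variables (D : based_root_datum) (Dred : reduced D).
Variables (a0 : root_idx D) (a0_highest : highest_root a0).
Implicit Types (a b : root_idx D).

Lemma positive_simple (i : 'I_(ss_rank D)) : positive (simple_idx i).
Proof.
apply/asboolP; exists (fun j => (j == i) : nat).
by rewrite (bigD1 i) //= eqxx big1 ?addr0 // => j /negPf ->.
Qed.

(** The reflection alters only the coefficient of [simple_idx i], so any other simple root in the
    support of [b] keeps its positive coefficient. *)
Lemma simple_refl_positive (i : 'I_(ss_rank D)) b :
  b <> simple_idx i -> positive b -> positive (act_root (refl (simple_idx i)) b).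
Proof.
move=> bi bp; have /asboolP[c bE] := bp.
have [/existsP[j /andP[ji cj]]|] := boolP [exists j, (j != i) && (c j != 0%N)].
  apply: contraT; rewrite -nneg_comb_opp_root => /asboolP[d].
  rewrite act_rootE /= /refl_up; set m := pairing _ _ => dE.
  have /simple_free/(_ j) : \sum_l root_of (simple_idx l) *~
      ((c l)%:Z + (d l)%:Z - (l == i)%:Z * m) = 0 :> Xup D.
    under eq_bigr do rewrite mulrzBr mulrzDr -!pmulrn.
    rewrite big_split /= sumrN big_split /= -bE -dE (bigD1 i) //= eqxx mul1r.
    rewrite big1 => [|l /negPf ->]; last by rewrite mul0r.
    by rewrite addr0 opprB addrCA subrr addr0 subrr.
  by rewrite (negPf ji) mul0r subr0; move: cj; case: (c j).
(* Now [b] is a multiple of a single simple root; reducedness leaves only that root and its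
   opposite. *)
move/existsPn => c0; exfalso.
have bci : root_of b = root_of (simple_idx i) *+ c i.
  rewrite bE (bigD1 i) //= big1 ?addr0 // => j ji.
  by have := c0 j; rewrite ji /= => /negPn/eqP ->.
have [|/root_inj //|bN] := @Dred (simple_idx i) b 1 (c i) erefl.
  by rewrite bci.
have := bp; rewrite /positive bN nneg_comb_opp_root.
by rewrite positive_simple.
Qed.

Lemma is_simple_refl_fin (i : 'I_(ss_rank D)) :
  is_simple_refl (fin (refl (simple_idx i))) (simple_idx i).
Proof.
have pairT0 b : crossing (fin (refl (simple_idx i))) b =
    - (~~ positive (act_root (refl (simple_idx i)) b))%:Z + (~~ positive b)%:Z.
  by rewrite /crossing /= pairing0r refl_inv sub0r.
have reflE : act_root (refl (simple_idx i)) (simple_idx i) = opp_root (simple_idx i).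
  apply: root_inj; rewrite act_rootE opp_rootE /= /refl_up pairing_coroot.
  by rewrite -pmulrn mulr2n opprD addrA subrr add0r.
split.
- by rewrite /fin; congr ExtWeyl; rewrite ?act_low0 ?addr0 ?refl_mul.
- by rewrite pairT0 reflE positive_opp_root positive_simple.
- have posb b : b <> simple_idx i -> positive b ->
      crossing (fin (refl (simple_idx i))) b = 0.
    by move=> bi bp; rewrite pairT0 simple_refl_positive // bp.
  move=> b bi bni; have [bp|bn] := boolP (positive b); first exact: posb.
  rewrite -[b]opp_rootK crossing_opp posb ?oppr0 // ?positive_opp_root //.
  by move=> /(congr1 (@opp_root D)); rewrite opp_rootK.
Qed.

(** Comparing [a0] with its opposite shows that twice [a0] is a nonnegative combination; for a
    negative [a0] it would vanish, although it pairs to 4 with the coroot. *)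
Lemma positive_highest : positive a0.
Proof.
have := nneg_combD (a0_highest a0) (a0_highest (opp_root a0)).
rewrite subrr add0r opp_rootE opprK -mulr2n.
have [//|an ap] := root_sign a0.
have /(congr1 (fun x => pairing x (coroot_of a0))) : root_of a0 *+ 2 = 0.
  by apply: nneg_comb_anti ap _; rewrite -mulNrn nneg_combMn.
by rewrite pmulrn pairingMzl pairing0l pairing_coroot.
Qed.

Lemma pairing_highest b : positive b -> b <> a0 ->
  pairing (root_of b) (coroot_of a0) = 0 \/ pairing (root_of b) (coroot_of a0) = 1.
Proof.
move=> bp ba; have [c cE] := refl_root a0 b; move: cE.
set m := pairing _ _ => cE; case: m cE => [[|[|n]]|n] cE; first by left.
- by right.
(* Here [m = n + 2]: both [a0 + c] and its negative [(a0 - b) + n a0] are nonnegative combinations,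
   hence zero, which forces [b = a0]. *)
- exfalso; have := a0_highest (opp_root c); rewrite opp_rootE opprK cE -pmulrn.
  have /nneg_comb_anti: nneg_comb (root_of a0 - root_of b + root_of a0 *+ n).
    by apply: nneg_combD (a0_highest b) _; apply: nneg_combMn _ positive_highest.
  have -> : - (root_of a0 - root_of b + root_of a0 *+ n) =
      root_of a0 + (root_of b - root_of a0 *+ n.+2).
    by rewrite !mulrS !opprD !opprK [RHS]addrCA addNKr -addrA addrCA.
  move=> X /X /eqP; rewrite addr_eq0 => /eqP abE.
  have := @nneg_comb_anti _ _ (a0_highest b); rewrite {1}abE opprK.
  move=> /(_ (nneg_combMn n positive_highest))/eqP.
  by rewrite subr_eq0 => /eqP/root_inj/esym.
(* Here [m = -(n + 1)]: [a0 - c = -(b + n a0)], so [b + n a0] vanishes, and then [b] does. *)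
- exfalso; have := a0_highest c; rewrite cE NegzE mulrNz opprK -pmulrn.
  have -> : root_of a0 - (root_of b + root_of a0 *+ n.+1) =
      - (root_of b + root_of a0 *+ n).
    by rewrite mulrS opprD [in RHS]opprD opprD addrCA addNKr.
  have np : nneg_comb (root_of a0 *+ n) := nneg_combMn _ positive_highest.
  move=> /(nneg_comb_anti (nneg_combD bp np))/eqP; rewrite addrC addr_eq0 => /eqP anE.
  have := root_neq0 b; rewrite (nneg_comb_anti bp) ?eqxx //.
  by rewrite -anE.
Qed.

(** A positive [b] other than [a0] pairs to 0 or 1 with the coroot of [a0]. In the first case the
    reflection fixes [b]; in the second it gives [b - a0], which is negative and cancels the 1
    coming from the translation. *)
Lemma is_simple_refl_affine :
  is_simple_refl (eps (coroot_of a0) * fin (refl a0))%g (opp_root a0).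
Proof.
set s := (_ * _)%g.
have sE b : crossing s b = pairing (root_of b) (coroot_of a0)
    - (~~ positive (act_root (refl a0) b))%:Z + (~~ positive b)%:Z.
  by rewrite /crossing /= addr0 mul1g refl_inv.
have s1 : crossing s a0 = 1.
  rewrite sE pairing_coroot positive_highest.
  suff -> : act_root (refl a0) a0 = opp_root a0.
    by rewrite positive_opp_root positive_highest.
  apply: root_inj; rewrite act_rootE opp_rootE /= /refl_up pairing_coroot.
  by rewrite -pmulrn mulr2n opprD addrA subrr add0r.
split; last 2 first.
- by rewrite crossing_opp s1.
- have posb b : b <> a0 -> positive b -> crossing s b = 0.
    move=> ba bp; have := pairing_highest bp ba; rewrite sE bp.
    have := act_rootE (refl a0) b; rewrite /= /refl_up.
    move=> + [bE|bE]; rewrite bE ?subr0 => rE.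
      by rewrite (root_inj rE) bp.
    suff /negPf -> : ~~ positive (act_root (refl a0) b) by [].
    rewrite -nneg_comb_opp_root rE opprB; exact: a0_highest.
  move=> b ban ba; rewrite opp_rootK in ba.
  have [bp|bn] := boolP (positive b); first exact: posb.
  rewrite -[b]opp_rootK crossing_opp posb ?oppr0 // ?positive_opp_root //.
  by move=> bE; apply: ban; rewrite -bE opp_rootK.
have reflN : refl_low a0 (coroot_of a0) = - coroot_of a0.
  by rewrite /refl_low pairing_coroot -pmulrn mulr2n opprD addrA subrr add0r.
congr ExtWeyl; rewrite /= ?mul1g ?refl_mul //.
by rewrite /act_low !addr0 /= reflN subrr.
Qed.

(* The gradient of the affine simple root of type i. *)
Definition simple_grad (i : 'I_(ss_rank D).+1) : root_idx D :=
  if unlift ord0 i is Some j then simple_idx j else opp_root a0.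

Lemma is_simple_refl_affrefl i : is_simple_refl (affrefl a0 i) (simple_grad i).
Proof.
rewrite /affrefl /simple_grad; case: unliftP => [j|] _.
  exact: is_simple_refl_fin.
exact: is_simple_refl_affine.
Qed.

End AffineSimple.

(** * Walks in the Hecke algebra *)

Section Walk.
Variables (D : based_root_datum) (Dred : reduced D).
Variables (a0 : root_idx D) (a0_highest : highest_root a0).
Variables (k0 : comPzRingType) (v u : k0) (vu1 : v * u = 1).
Implicit Types (x y : ext_weyl D).

Local Notation T := (Ttil a0 v u).
Local Notation TV := (TtilV a0 v).

Lemma TtilM x y : ext_len (x * y)%g = (ext_len x + ext_len y)%N ->
  T (x * y)%g = T x * T y.
Proof.
move=> xy; have gM : braid_gen (x * y)%g = (braid_gen x * braid_gen y)%g.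
  apply/esym; rewrite /braid_gen /pres_gen [LHS]pres_mulE.
  by apply/pres_classP/pres_rel; exists x, y.
rewrite /Ttil /hecke_of gM -[RHS]gquot_scaleAl -gquot_scaleAr scalerA -exprD -xy.
by rewrite gquot_mulE galg_deltaM.
Qed.

Lemma Ttil_mulI x : injective (fun f => T x * f).
Proof.
have [_ TVT] := TtilK a0 x vu1.
by move=> f g /(congr1 ( *%R (TV x))); rewrite !mulrA TVT !mul1r.
Qed.

(** If multiplication by [s] shortens [x], then [T x = T (x * s) * T s], and the step multiplies by
    the inverse of [T s]; otherwise the lengths add. *)
Lemma Ttil_simple (x : ext_weyl D) i :
  T (x * affrefl a0 i)%g =
  T x * Ttil_exp a0 v u (affrefl a0 i)
    (if 0 < crossing x (act_root (linpart x) (simple_grad a0 i)) then -1 else 1).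
Proof.
have sP := is_simple_refl_affrefl Dred a0_highest i.
have := ext_len_mul_simple x sP; have sl := ext_len_simple sP.
have [ss _ _] := sP; set s := affrefl a0 i in sP sl ss *.
case: ifP => _ xs; last by rewrite TtilM ?sl ?addn1.
have -> : T x = T (x * s)%g * T s.
  by rewrite -TtilM -mulgA ss mulg1 // xs sl addn1.
rewrite -mulrA; have [TTV _] := TtilK a0 s vu1.
by rewrite -[Ttil_exp _ _ _ _ _]/(TV s) TTV mulr1.
Qed.

(** The product inside [word_sign], bounded by a natural number so that [nu = k] gives the whole
    word. *)
Definition prefix k (i : 'I_k -> 'I_(ss_rank D).+1) (nu : nat) : ext_weyl D :=
  (\prod_(mu < k | (mu < nu)%N) affrefl a0 (i mu))%g.

Lemma prefixS k (i : 'I_k.+1 -> 'I_(ss_rank D).+1) nu : (nu <= k)%N ->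
  prefix i nu = prefix (fun mu => i (widen_ord (leqnSn k) mu)) nu.
Proof.
move=> nuk; rewrite /prefix big_mkcond big_ord_recr /= ltnNge nuk mulg1.
by rewrite [RHS]big_mkcond.
Qed.

Lemma prefix_full k (i : 'I_k -> 'I_(ss_rank D).+1) :
  prefix i k = (\prod_(mu < k) affrefl a0 (i mu))%g.
Proof. by apply: eq_bigl => mu; rewrite ltn_ord. Qed.

(* Translating far into the dominant chamber turns the orientation signs into the
   directions in which the length changes along the walk. *)
Lemma Ttil_walk (y : Xlow D) k (i : 'I_k -> 'I_(ss_rank D).+1) :
  (forall (nu : 'I_k) b, positive b -> 0 < crossing (eps y * prefix i nu)%g b) ->
  T (eps y * \prod_(nu < k) affrefl a0 (i nu))%g =
  T (eps y) * \prod_(nu < k) Ttil_exp a0 v u (affrefl a0 (i nu))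
    (if positive (act_root (linpart (prefix i nu)) (simple_grad a0 (i nu)))
     then -1 else 1).
Proof.
elim: k i => [|k IHk] i ypos; first by rewrite !big_ord0 mulg1 mulr1.
rewrite !big_ord_recr /= mulgA Ttil_simple IHk.
  rewrite mulrA; congr (_ * _ * _).
    by apply: eq_bigr => nu _; rewrite -prefixS // ltnW.
  have := ypos ord_max; rewrite prefixS // prefix_full /= mul1g => {}ypos.
  set b := act_root _ _; congr Ttil_exp.
  have [/ypos ->//|bn] := boolP (positive b).
  (* For negative [b] the opposite root has positive crossing, so that of [b] is negative and both
     tests select the exponent 1. *)
  have /ypos : positive (opp_root b) by rewrite positive_opp_root.
  by rewrite crossing_opp oppr_gt0 ltNge le_eqVlt => /norP[_ /negPf ->].
move=> nu b /(ypos (widen_ord (leqnSn k) nu)).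
by rewrite prefixS // ltnW /=.
Qed.

(** Write [lam = l1 - l2]. All four terms of [y + l1 = (y + lam) + l2] are dominant, so lengths add
    on both sides and [T (eps l2)] cancels. *)
Lemma Ttil_Theta (y lam : Xlow D) : dominant y -> dominant (y + lam) ->
  T (eps y) * Theta a0 v u lam = T (eps (y + lam)).
Proof.
move=> yd yld; rewrite /Theta.
have : [set p : Xlow D * Xlow D |
    [/\ dominant p.1, dominant p.2 & lam = p.1 - p.2]] (dominant_pair lam).
  (* The pair [(y + lam, y)] is admissible, so [xget] does not fall back on its default. *)
  by apply: xgetPex; exists (y + lam, y); split=> //=; rewrite addrC addKr.
case: dominant_pair => l1 l2 /= [l1d l2d ll].
have TD z z' : dominant z -> dominant z' -> T (eps (z + z')) = T (eps z) * T (eps z').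
  by move=> zd zd'; rewrite epsD TtilM // -epsD ext_len_dominantD.
rewrite mulrA -TD //; have -> : y + l1 = (y + lam) + l2.
  by rewrite ll -addrA subrK.
by have [TTV _] := TtilK a0 (eps l2) vu1; rewrite TD // -mulrA TTV mulr1.
Qed.

End Walk.

(** * Walls of the base alcove *)

Section Geometry.
Variables (R : realType) (D : based_root_datum).
Local Notation V := 'cV[R]_(lat_rank D).
Implicit Types (x : Xup D) (y : Xlow D) (p q : V) (w : weyl D) (g h : ext_weyl D).

Lemma pairingRDr x p q : pairingR x (p + q) = pairingR x p + pairingR x q.
Proof.
by rewrite /pairingR -big_split; apply: eq_bigr => j _; rewrite mxE mulrDr.
Qed.

Lemma pairingRZr x (c : R) p : pairingR x (c *: p) = c * pairingR x p.
Proof.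
by rewrite /pairingR mulr_sumr; apply: eq_bigr => j _; rewrite mxE mulrCA.
Qed.

Lemma pairingRDl x x' p : pairingR (x + x') p = pairingR x p + pairingR x' p.
Proof.
rewrite /pairingR -big_split; apply: eq_bigr => j _.
by rewrite pairingDl rmorphD mulrDl.
Qed.

Lemma pairingRNl x p : pairingR (- x) p = - pairingR x p.
Proof.
rewrite /pairingR -sumrN; apply: eq_bigr => j _.
by rewrite pairingNl rmorphN mulNr.
Qed.

Lemma pairingRMzl x n p : pairingR (x *~ n) p = n%:~R * pairingR x p.
Proof.
rewrite /pairingR mulr_sumr; apply: eq_bigr => j _.
by rewrite pairingMzl intrM mulrAC mulrC.
Qed.

Lemma pairing_sumr x (I : Type) (r : seq I) (F : I -> Xlow D) :
  pairing x (\sum_(j <- r) F j) = \sum_(j <- r) pairing x (F j).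
Proof. exact: (big_morph (pairing x) (pairingDr x) (pairing0r x)). Qed.

Lemma pairingR_lowR x y : pairingR x (lowR R y) = (pairing x y)%:~R.
Proof.
rewrite {2}[y]basisP pairing_sumr rmorph_sum /=; apply: eq_bigr => j _.
by rewrite mxE pairingMzr intrM.
Qed.

Lemma pairingR_act_lowR x w p :
  pairingR x (act_lowR w p) = pairingR (act_up w^-1%g x) p.
Proof.
rewrite /act_lowR.
have -> : pairingR x (\sum_j p j 0 *: lowR R (act_low w (Defs.basis j))) =
    \sum_j pairingR x (p j 0 *: lowR R (act_low w (Defs.basis j))).
  apply: (big_morph (pairingR x) (pairingRDr x)).
  by rewrite -(scale0r 0) pairingRZr mul0r.
apply: eq_bigr => j _.
by rewrite pairingRZr pairingR_lowR pairing_actV invgK mulrC.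
Qed.

Lemma pairingR_ext_act x g p : pairingR x (ext_act g p) =
  pairingR (act_up (linpart g)^-1%g x) p + (pairing x (transl g))%:~R.
Proof. by rewrite pairingRDr pairingR_act_lowR pairingR_lowR. Qed.

Lemma pairingR_inj p q : (forall x, pairingR x p = pairingR x q) -> p = q.
Proof.
have coord p' j : pairingR (cobasis j) p' = p' j 0.
  rewrite /pairingR (bigD1 j) //= pairing_dual eqxx mul1r big1 ?addr0 // => l lj.
  by rewrite pairing_dual eq_sym (negPf lj) mul0r.
by move=> pq; apply/matrixP => j l; rewrite ord1 -!coord.
Qed.

Lemma ext_actVK g : cancel (@ext_act D R g^-1%g) (ext_act g).
Proof.
move=> p; apply: pairingR_inj => x; rewrite !pairingR_ext_act /= invgK.
rewrite -[act_up _ (act_up _ x)]/(act_up (linpart g * (linpart g)^-1)%g x) mulgV.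
by rewrite pairingNr pairing_actV invgK -act_lowM mulgV rmorphN subrK.
Qed.

Lemma pairingR_root_ext_act a g p :
  pairingR (root_of (act_root (linpart g) a)) (ext_act g p) =
  pairingR (root_of a) p
  + (pairing (root_of (act_root (linpart g) a)) (transl g))%:~R.
Proof. by rewrite pairingR_ext_act -act_rootE act_rootK. Qed.

Section Walls.
Variable a0 : root_idx D.

(** The value of the gradient on the wall of type [i]. For type 0 the gradient is the opposite of
    [a0] and the wall is [a0 = 1], whence [-1]. *)
Definition simple_offset (i : 'I_(ss_rank D).+1) : int :=
  if unlift ord0 i is Some j then 0 else -1.

Lemma affrefl_fixed i p : ext_act (affrefl a0 i) p = p <->
  pairingR (root_of (simple_grad a0 i)) p = (simple_offset i)%:~R.
Proof.
(* Such a [g] moves [p] along the coroot of [a] by [n] minus the value of the root at [p]; pairing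
   with the root itself detects this motion. *)
have reflP a (n : int) g : linpart g = refl a -> transl g = coroot_of a *~ n ->
    (ext_act g p = p <-> pairingR (root_of a) p = n%:~R).
  move=> gl gt; have pE x : pairingR x (ext_act g p) =
      pairingR x p + (pairing x (coroot_of a))%:~R * (n%:~R - pairingR (root_of a) p).
    rewrite pairingR_ext_act gl refl_inv gt /= /refl_up pairingRDl pairingRNl.
    by rewrite pairingRMzl pairingMzr intrM mulrBr addrA addrAC.
  split=> [gp|pn]; last by apply: pairingR_inj => x; rewrite pE pn subrr mulr0 addr0.
  by have := pE (root_of a); rewrite gp pairing_coroot; lra.
rewrite /affrefl /simple_grad /simple_offset; case: unliftP => [j|] _.
  by apply: reflP; rewrite ?mulr0z.
rewrite opp_rootE pairingRNl.
have -> : (- pairingR (root_of a0) p = (-1)%:~R) <-> pairingR (root_of a0) p = 1%:~R.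
  by split; lra.
by apply: reflP; rewrite /= ?mul1g ?act_low0 ?addr0.
Qed.

Lemma wallE g i : wall a0 g i =
  @hyperplane D R (act_root (linpart g) (simple_grad a0 i))
    (simple_offset i
     + pairing (root_of (act_root (linpart g) (simple_grad a0 i))) (transl g)).
Proof.
apply/seteqP; split=> [_ [p /= /affrefl_fixed pE <-]|q /= qE].
  by rewrite /hyperplane /= pairingR_root_ext_act pE rmorphD.
exists (ext_act g^-1%g q); last exact: ext_actVK.
apply/affrefl_fixed; move: qE; rewrite /hyperplane /= -{1}(ext_actVK g q).
by rewrite pairingR_root_ext_act rmorphD => /addIr.
Qed.

End Walls.

Lemma pairingR_continuous x : continuous (fun p : V => pairingR x p).
Proof.
apply: continuous_big => [|j _]; first exact: add_continuous.
by move=> p; apply: continuousM; [exact: cst_continuous|exact: coord_continuous].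
Qed.

(** * Position of alcoves relative to their walls *)

Section BaseAlcove.
Variables (a0 : root_idx D) (A : set V) (A_base : base_alcove A).

Lemma base_alcove_neq0 : A !=set0.
Proof.
have [[p pH ->] _ _] := A_base.
by exists p; exact: connected_component_refl.
Qed.

Lemma base_alcove_dominant p a : A p -> positive a -> 0 < pairingR (root_of a) p.
Proof. by case: A_base => _ Ad _ /Ad /= + ap; exact. Qed.

(** Near the origin the alcove has points where [a0 < 1]. If [a0] also reached 1 or more,
    connectedness would give a point of the alcove on the hyperplane [a0 = 1]. *)
Lemma base_alcove_highest p : A p -> pairingR (root_of a0) p < 1.
Proof.
move=> Ap; have [[p0 _ AE] _ /= A0] := A_base.
pose f (z : V) := pairingR (root_of a0) z.
have [|q [Aq fq]] := A0 [set z | f z < 1].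
  have f0 : f 0 = 0 by rewrite /f -(scale0r 0) pairingRZr mul0r.
  have := @pairingR_continuous (root_of a0) 0 [set r | r < 1].
  apply; rewrite -/(f 0) f0; apply: open_nbhs_nbhs; split; first exact: open_lt.
  exact: ltr01.
rewrite ltNge; apply/negP => fp.
have fA : connected [set f z | z in A].
  apply: connected_continuous_connected.
    by rewrite AE; exact: component_connected.
  by apply: continuous_subspaceT => z; exact: pairingR_continuous.
have /connected_intervalP fAi := fA.
have [|z Az fz1] := fAi (f q) (f p) (imageP f Aq) (imageP f Ap) 1.
  by rewrite fp andbT ltW.
have := Az; rewrite AE => /connected_component_sub; apply.
by exists a0 => //; exists 1.
Qed.

Lemma base_alcove_simple p i : A p ->
  (simple_offset i)%:~R < pairingR (root_of (simple_grad a0 i)) p.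
Proof.
rewrite /simple_offset /simple_grad => Ap; case: unliftP => [j|] _.
  exact: base_alcove_dominant (positive_simple j).
by rewrite opp_rootE pairingRNl rmorphN ltrN2; exact: base_alcove_highest.
Qed.

(** The image of [A] under [g] lies on the side of its wall where the transported gradient [c] is
    larger, so only the sign of [c] matters. *)
Lemma wall_signE g i : wall_sign a0 A g i =
  if positive (act_root (linpart g) (simple_grad a0 i)) then -1 else 1.
Proof.
set c := act_root _ _; pose m := simple_offset i + pairing (root_of c) (transl g).
have wE : wall a0 g i = @hyperplane D R c m := wallE a0 g i.
have side p : A p -> m%:~R < pairingR (root_of c) (ext_act g p).
  move=> Ap; rewrite pairingR_root_ext_act rmorphD ltrD2r; exact: base_alcove_simple.
rewrite /wall_sign; have [cp|cn] := boolP (positive c); last first.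
  rewrite asboolT //; exists (opp_root c), (- m); split.
  - by rewrite positive_opp_root.
  - rewrite wE; apply/seteqP.
    split=> p; rewrite /hyperplane /= opp_rootE pairingRNl rmorphN.
      by move=> ->.
    exact: oppr_inj.
  - by move=> _ [p /side cm <-] /=; rewrite opp_rootE pairingRNl rmorphN ltrN2.
(* The negative side is defined by an existential, so every description [(a, j)] of the wall must be
   excluded, not only [(c, m)]. *)
rewrite asboolF // => -[a [j [ap]]]; rewrite wE => cE sub.
have [p Ap] := base_alcove_neq0.
have /= qj := sub _ (imageP (ext_act g) Ap); have mq := side _ Ap.
(* Moving from x a in a dominant direction reaches H_{a,j} without meeting the wall. *)
have app := base_alcove_dominant Ap ap; have cpp := base_alcove_dominant Ap cp.
pose s := (j%:~R - pairingR (root_of a) (ext_act g p)) / pairingR (root_of a) p.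
have s0 : 0 < s by rewrite divr_gt0 // subr_gt0.
have : hyperplane a j (ext_act g p + s *: p).
  by rewrite /hyperplane /= pairingRDr pairingRZr divfK ?gt_eqF // addrC subrK.
rewrite -cE /hyperplane /= pairingRDr pairingRZr => zm.
by have := mulr_gt0 s0 cpp; lra.
Qed.

(** A large multiple of a point of the base alcove remains strictly dominant after its coordinates
    are rounded down; [C a] bounds the rounding error seen by the root [a]. *)
Lemma exists_strictly_dominant :
  exists y : Xlow D, forall a, positive a -> 0 < pairing (root_of a) y.
Proof.
have [p Ap] := base_alcove_neq0.
pose C (a : root_idx D) : R := \sum_j `|(pairing (root_of a) (Defs.basis j))%:~R|.
have C0 a : 0 <= C a by apply: sumr_ge0.
(* The sum dominates each of its nonnegative terms, so one [N] serves all positive roots. *)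
pose N := (Num.trunc (\sum_(a | positive a) C a / pairingR (root_of a) p)).+1.
exists (\sum_j Defs.basis j *~ Num.floor (N%:R * p j 0)) => a ap.
have app := base_alcove_dominant Ap ap.
have NC : C a < N%:R * pairingR (root_of a) p.
  rewrite -ltr_pdivrMr //; apply: le_lt_trans (truncnS_gt _).
  rewrite (bigD1 a) //= lerDl; apply: sumr_ge0 => b /andP[bp _].
  by rewrite divr_ge0 // ltW // base_alcove_dominant.
rewrite -(ltr0z R) pairing_sumr rmorph_sum /=.
apply: lt_le_trans (_ : 0 < N%:R * pairingR (root_of a) p - C a) _.
  by rewrite subr_gt0.
rewrite /pairingR mulr_sumr -sumrB; apply: ler_sum => j _.
rewrite pairingMzr intrM mulrCA lerBlDl -lerBlDr -mulrBr.
apply: le_trans (ler_norm _) _; rewrite normrM ler_piMr //.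
have /andP[lo hi] := floor_itv (N%:R * p j 0).
by rewrite ger0_norm ?subr_ge0 // lerBlDl; move: hi; rewrite intrD => /ltW.
Qed.

End BaseAlcove.
End Geometry.

Theorem corollary4p1p1 (R : realType) (D : based_root_datum)
  (Dred : reduced D) (Dirr : irreducible D)
  (a0 : root_idx D) (a0_highest : highest_root a0)
  (A : set 'cV[R]_(lat_rank D)) (A_base : base_alcove A)
  (k0 : comPzRingType) (v u : k0) (vu1 : v * u = 1)
  (lam : Xlow D) (k : nat) (i : 'I_k -> 'I_(ss_rank D).+1) (tau : ext_weyl D)
  (tau_Omega : ext_len tau = 0%N)
  (lam_word : eps lam = ((\prod_(nu < k) affrefl a0 (i nu)) * tau)%g)
  (word_reduced : k = ext_len (eps lam)) :
  Theta a0 v u lam =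
    (\prod_(nu < k) Ttil_exp a0 v u (affrefl a0 (i nu)) (word_sign a0 A i nu))
    * Ttil a0 v u tau.
Proof.
have [rho rhoP] := exists_strictly_dominant A_base.
(* [M] bounds every crossing of every prefix and every pairing with [lam]; a translation [y] beyond
   [M] is deep enough for the walk and keeps [y + lam] dominant. *)
pose M := (\sum_(nu < k) \sum_b `|crossing (prefix a0 i nu) b|
           + \sum_b `|pairing (root_of b) lam|)%N.
pose y := rho *~ M.+1.
have yM b : positive b -> M%:Z < pairing (root_of b) y.
  move=> /rhoP; rewrite pairingMzr; move: (pairing _ _) (M) => m n; nia.
have yd : dominant y by move=> b /yM; lia.
have yld : dominant (y + lam).
  move=> b bp; have := yM b bp; rewrite pairingDr {1}/M [X in (_ + X)%N](bigD1 b) //=.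
  by move: (pairing _ y) (pairing _ lam) => m n; lia.
(* Left multiplication by the invertible [Ttil (eps y)] reduces the claim to the walk starting at
   [eps y]; [tau], of length 0, splits off at its end. *)
apply: (Ttil_mulI (a0 := a0) vu1 (x := eps y)); rewrite Ttil_Theta // epsD lam_word.
rewrite mulgA TtilM; last by rewrite (ext_len_mul0 _ tau_Omega) tau_Omega addn0.
rewrite mulrA; congr (_ * _).
rewrite (Ttil_walk Dred a0_highest vu1).
  congr (_ * _); apply: eq_bigr => nu _; congr Ttil_exp.
  by rewrite /word_sign (wall_signE _ A_base).
move=> nu b bp; have := yM b bp.
(* The translation contributes more than [M] and the prefix at least [-M], as the term of [M] at
   [(nu, b)] shows. *)
rewrite crossingM crossing_eps /= invg1 act_root1.
rewrite {1}/M (bigD1 nu) //= (bigD1 b) //=.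
by move: (pairing _ _) (crossing _ _) => m n; lia.
Qed.
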